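(* Let $F$ be a field of characteristic zero such that $[F(\zeta_8):F]=4$, where $\zeta_8$ is a primitive $8$-th root of unity (e.g. $F=\mathbb{Q}$), and let $G=\mathrm{SL}_2(F)$. Then the word $x^4y^4$ does not represent $-I_2$; that is, there are no $A,B\in\mathrm{SL}_2(F)$ with $A^4B^4=-I_2$.
   Context: $I_2$ denotes the $2\times 2$ identity matrix. *)

(* Defs.v *)
From HB Require Import structures.
From mathcomp Require Import all_boot all_order all_algebra all_field.

Set Implicit Arguments.
Unset Strict Implicit.
Unset Printing Implicit Defensive.

Import GRing.Theory.
Local Open Scope ring_scope.

Definition SL (R : comNzRingType) (n : nat) : {pred 'M[R]_n} :=
  [pred A | \det A == 1].

Arguments SL : clear implicits.

(* Main.v *)
Require Import Defs.
From HB Require Import structures.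
From mathcomp Require Import all_boot all_order all_algebra all_field.
From mathcomp Require Import ring.

Set Implicit Arguments.
Unset Strict Implicit.
Unset Printing Implicit Defensive.

Import GRing.Theory.
Local Open Scope ring_scope.

(** By Cayley-Hamilton, [A ^+ 4 = s *: A + t%:M].  If [s != 0], then [A] is a
    polynomial in [A ^+ 4 = - B ^- 4], so [A] and [B] commute and
    [(A * B) ^+ 4 = -1].  If [s = 0], then [A ^+ 4 = t%:M] with [t ^+ 2 = 1],
    so [A ^+ 4 = -1] or [B ^+ 4 = -1].  In all cases some 2 x 2 matrix is a root
    of ['X^4 + 1]; its minimal polynomial is a factor of degree at most 2 of
    ['X^4 + 1], which is irreducible because [zeta8] has degree 4. *)

Lemma Cayley_Hamilton_mx22 (R : comNzRingType) (A : 'M[R]_2) :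
  A ^+ 2 = \tr A *: A - (\det A)%:M.
Proof.
have sz := size_char_poly A.
have -> : \tr A = - (char_poly A)`_1 by rewrite (char_poly_trace A) // opprK.
have -> : \det A = (char_poly A)`_0.
  by rewrite char_poly_det expr2 mulrN1 opprK mul1r.
have lc : (char_poly A)`_2 = 1.
  by have /monicP := char_poly_monic A; rewrite lead_coefE sz.
apply/eqP; rewrite -subr_eq0; apply/eqP; rewrite -[RHS](Cayley_Hamilton A).
(* Expand the monic polynomial [char_poly A] into its three coefficients and evaluate it at [A],
   where it vanishes. *)
rewrite -[char_poly A in RHS]coefK sz poly_def !big_ord_recl big_ord0 /= lc.
rewrite !rmorphD /= rmorph0 !linearZ /= !rmorphXn /= horner_mx_X.
rewrite expr0 expr1 scale1r scalemx1 addr0 scaleNr opprB opprK.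
by rewrite [LHS]addrC -addrA.
Qed.

Lemma SL2_exp4 (R : comNzRingType) (A : 'M[R]_2) : A \in SL R 2 ->
  {st : R * R | A ^+ 4 = st.1 *: A + st.2%:M}.
Proof.
rewrite inE => /eqP detA; have := Cayley_Hamilton_mx22 A; rewrite detA.
(* Squaring [A ^+ 2 = a *: A - 1] gives [a ^+ 2 *: A ^+ 2 - 2 * a *: A + 1]; substituting for
   [A ^+ 2] again yields these coefficients. *)
set a := \tr A => A2; exists (a ^+ 3 - 2 * a, 1 - a ^+ 2) => /=.
rewrite (exprM A 2 2) A2 expr2 mulrBl !mulrBr -!scalerAl -!scalerAr -expr2 A2.
rewrite !mul1r !mulr1.
apply/matrixP=> i j; rewrite !mxE.
by case: (i == j); rewrite ?mulr1n ?mulr0n; ring.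
Qed.

Lemma prim8_exp4 (R : idomainType) (z : R) : 8.-primitive_root z -> z ^+ 4 = -1.
Proof.
move=> z_prim; apply/eqP; have := prim_expr_order z_prim.
move/eqP; rewrite (exprM z 4 2) sqrf_eq1 => /orP[|//].
by rewrite -(prim_order_dvd z_prim).
Qed.

(** The minimal polynomial of [z] over [1%VS] divides the image of [p], and its size exceeds the
    degree of [z] by one. *)
Lemma size_root_adjoin (F : fieldType) (L : fieldExtType F) (z : L)
    (p : {poly F}) : p != 0 -> root (map_poly (in_alg L) p) z ->
  (\dim <<1; z>>%VS < size p)%N.
Proof.
move=> p0 rpz; have pF : map_poly (in_alg L) p \is a polyOver 1%VS.
  by apply/polyOver1P; exists p.
have := dvdp_leq _ (minPoly_dvdp pF rpz).
rewrite map_poly_eq0 p0 size_minPoly size_map_poly => /(_ isT).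
by rewrite adjoin_degreeE dimv1 divn1.
Qed.

Lemma mx22_exp4_neqN1 (F : fieldType) (L : fieldExtType F) (z : L)
    (D : 'M[F]_2) : 8.-primitive_root z -> \dim <<1; z>>%VS = 4%N ->
  D ^+ 4 <> -1.
Proof.
move=> z_prim dimz D4; pose P : {poly F} := 'X^4 + 1%:P.
have P0 : P != 0 by rewrite -size_poly_eq0 size_XnaddC.
have dvdP : mxminpoly D %| P.
  apply: mxminpoly_min.
  by rewrite /P polyC1 rmorphD rmorphXn rmorph1 /= horner_mx_X D4 addNr.
have [q Pq] := dvdpP _ _ dvdP.
have sp : (size (mxminpoly D) <= 3)%N.
  rewrite -(size_char_poly D) dvdp_leq ?mxminpoly_dvd_char //.
  by rewrite monic_neq0 ?char_poly_monic.
have sp1 : (1 < size (mxminpoly D))%N.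
  by rewrite size_mxminpoly ltnS mxminpoly_nonconstant.
have q0 : q != 0 by apply: contraNneq P0 => q0; rewrite Pq q0 mul0r.
have p0 : mxminpoly D != 0 by rewrite monic_neq0 ?mxminpoly_monic.
(* The sizes of [q] and [mxminpoly D] add up to 6, and the latter is at least 2. *)
have sq : (size q <= 4)%N.
  have : size P = 5%N by rewrite size_XnaddC.
  rewrite Pq size_mul // => sz; move: sz sp1.
  case: (size (mxminpoly D)) => [|[|k]] //.
  by rewrite !addnS /= => -[<-] _; rewrite leq_addr.
(* As a root of [P], [z] is a root of [q] or of [mxminpoly D]; either would need size at least 5. *)
have : root (map_poly (in_alg L) P) z.
  rewrite /root /P polyC1 rmorphD rmorph1 /= map_polyXn.
  by rewrite !hornerE prim8_exp4 // addNr.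
rewrite Pq rmorphM rootM => /orP[] /size_root_adjoin; rewrite dimz.
- by move/(_ q0); rewrite ltnNge sq.
- by move/(_ p0); rewrite ltnNge (leq_trans sp).
Qed.

Theorem proposition4p1 (F : fieldType) (L : fieldExtType F) (zeta8 : L)
    (charF0 : [pchar F] =i pred0)
    (zeta8_prim : 8.-primitive_root zeta8)
    (degF : \dim <<1; zeta8>>%VS = 4%N) :
  ~ exists A B : 'M[F]_2,
      [/\ A \in SL F 2, B \in SL F 2 & A ^+ 4 *m B ^+ 4 = - 1%:M].
Proof.
case=> A [B [SLA _ AB]]; move: AB; rewrite mulmxE => AB.
have noD D := @mx22_exp4_neqN1 F L zeta8 D zeta8_prim degF.
have [[s t] /= A4] := SL2_exp4 SLA.
have [s0|s0] := eqVneq s 0.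
  move: A4; rewrite s0 scale0r add0r => A4.
  (* Take determinants in [A ^+ 4 = t%:M]. *)
  have : t ^+ 2 == 1.
    rewrite -det_scalar -A4; move: SLA; rewrite inE => /eqP detA.
    by rewrite 3!exprS -!mulmxE !det_mulmx expr1 detA !mulr1.
  rewrite sqrf_eq1 => /orP[] /eqP t1.
  - by apply: (noD B); rewrite -AB A4 t1 mul1r.
  - by apply: (noD A); rewrite A4 t1 raddfN.
have BA4 : GRing.comm B (A ^+ 4).
  (* A one-sided inverse of a square matrix is two-sided, so [- A ^+ 4] inverts [B ^+ 4] and
     commutes with [B]. *)
  have B4V : B ^+ 4 * - A ^+ 4 = 1.
    by apply: mulmx1C; rewrite mulmxE mulNr AB opprK.
  have -> : A ^+ 4 = - (B ^+ 4)^-1.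
    rewrite -[RHS]mulr1 -B4V mulNr mulrA mulVr ?mul1r ?opprK //.
    by apply/unitrP; exists (- A ^+ 4); rewrite mulNr AB opprK.
  exact/commrN/commrV/commrX.
have BA : GRing.comm B A.
  have -> : A = s^-1 *: (A ^+ 4 - t%:M) by rewrite A4 addrK scalerK.
  rewrite /GRing.comm -scalerAl -scalerAr mulrBl mulrBr BA4.
  by rewrite -!mulmxE scalar_mxC.
by apply: (noD (A * B)); rewrite exprMn_comm //; exact/commr_sym.
Qed.
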